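(* There exists an absolute constant $c>0$ such that, for the random graph $G=G(n,0.5)$, with high probability $$ bc(G)\;\leq\; n-(2+2c)\log_2 n \;\leq\; n-(1+c)\,\alpha(G), $$ that is, the probability that both inequalities hold tends to $1$ as $n\to\infty$.
   Context: All graphs are finite, simple and undirected. For a graph $G=(V,E)$, $bc(G)$ denotes the minimum number of pairwise edge-disjoint complete bipartite subgraphs of $G$ (bicliques of $G$, not necessarily induced) such that each edge of $G$ belongs to exactly one of them. $\alpha(G)$ denotes the maximum size of an independent set of $G$. $G(n,0.5)$ is the random graph on $n$ labeled vertices in which each pair of distinct vertices is an edge independently with probability $1/2$. ''With high probability'' means with probability tending to $1$ as $n$ tends to infinity. *)

(* Defs.v *)
From HB Require Import structures.
From mathcomp Require Import all_boot all_order all_algebra.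

Set Implicit Arguments.
Unset Strict Implicit.
Unset Printing Implicit Defensive.

Record sgraph (T : finType) := SGraph {
  edges :> {set {set T}};
  edgesP : [forall e in edges, #|e| == 2] }.

HB.instance Definition _ (T : finType) := [isSub for @edges T].
HB.instance Definition _ (T : finType) := [Finite of sgraph T by <:].

Section GraphParameters.
Variables (T : finType) (G : sgraph T).

Definition adj (x y : T) : bool := [set x; y] \in edges G.

Definition independent (A : {set T}) : bool :=
  [forall x in A, forall y in A, ~~ adj x y].

Definition alpha : nat := \max_(A : {set T} | independent A) #|A|.

Definition cross_edges (A B : {set T}) : {set {set T}} :=
  [set [set x; y] | x in A, y in B].

(* A biclique has nonempty sides, hence no isolated vertex, so it is determined
   by its edge set F. *)
Definition is_biclique (F : {set {set T}}) : bool :=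
  (F \subset edges G) &&
  [exists A : {set T}, exists B : {set T},
    [&& A != set0, B != set0, [disjoint A & B] & F == cross_edges A B]].

Definition biclique_partition (P : {set {set {set T}}}) : bool :=
  partition P (edges G) && [forall F in P, is_biclique F].

Definition bc_spec (k : nat) : bool :=
  [exists P : {set {set {set T}}}, biclique_partition P && (#|P| == k)].

Lemma bc_spec_ex : exists k, bc_spec k.
Proof.
pose P := [set [set e] | e in edges G].
exists #|P|; apply/existsP; exists P; rewrite eqxx andbT; apply/andP; split.
  apply/and3P; split.
  - apply/eqP/setP => e; apply/bigcupP/idP.
      by case=> F /imsetP[f fG ->]; rewrite inE => /eqP->.
    by move=> eG; exists [set e]; rewrite ?inE //; apply/imsetP; exists e.
  - apply/trivIsetP => _ _ /imsetP[e _ ->] /imsetP[f _ ->] ef.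
    rewrite disjoints1 inE; apply: contraNneq ef => ->; exact: eqxx.
  - apply/negP => /imsetP[e _] /setP/(_ e); by rewrite !inE eqxx.
apply/forall_inP => _ /imsetP[e eG ->]; apply/andP; split; first by rewrite sub1set.
have /cards2P[x [y [xy ->]]] : #|e| == 2 by exact: (forall_inP (edgesP G)).
apply/existsP; exists [set x]; apply/existsP; exists [set y].
apply/and4P; split.
- by apply/set0Pn; exists x; rewrite inE.
- by apply/set0Pn; exists y; rewrite inE.
- by rewrite disjoints1 inE.
- by rewrite /cross_edges imset2_set1l imset_set1.
Qed.

Definition bc : nat := ex_minn bc_spec_ex.

End GraphParameters.

From mathcomp Require Import all_classical all_reals all_analysis.

Import Order.TTheory GRing.Theory Num.Theory.
Local Open Scope ring_scope.

Section RandomGraph.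
Variable R : realType.

(* G(n, p): the product over all pairs e is the probability of the graph G when
   every pair is an edge independently with probability p. *)
Definition gnp_weight (p : R) (n : nat) (G : sgraph 'I_n) : R :=
  \prod_(e : {set 'I_n} | #|e| == 2%N) (if e \in edges G then p else 1 - p).

Definition gnp_pr (p : R) (n : nat) (A : pred (sgraph 'I_n)) : R :=
  \sum_(G : sgraph 'I_n | A G) gnp_weight p G.

Definition log2 (x : R) : R := ln x / ln 2.

End RandomGraph.

(* Main.v *)
Require Import Defs.
From HB Require Import structures.
From mathcomp Require Import all_boot all_order all_algebra.
From mathcomp Require Import zify ring lra.

Set Implicit Arguments.
Unset Strict Implicit.
Unset Printing Implicit Defensive.

(** An independent set of size s saves s - 1 stars over the trivial decomposition, but G(n, 1/2)
    has, with high probability, none of size larger than 2 log2 n. The saving comes instead from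
    m disjoint pairs of nonadjacent vertices (twins) such that, for any two of the pairs, one of
    them is uniform to each vertex of the other: a vertex of the other pair sees both of its
    vertices or neither. Then every pair can be one side of a single biclique, which takes all
    the edges towards vertices for which the pair is responsible, and every other vertex is the
    centre of a star.
    This decomposes G into n - m bicliques ([bc_le_twins]).

    Between two pairs, 6 of the 16 patterns of four adjacencies are allowed, so m pairs work with
    probability 2 ^ (- m) (3 / 8) ^ (m (m - 1) / 2), against about n ^ (2 m) choices. The expected
    number of good families is large as long as m < 4 / log2 (8 / 3) log2 n, which is about
    2.8 log2 n and so well above 2 log2 n.

    To get existence, the second moment method is applied with the i-th pair chosen from its own
    cell, one vertex from each side of it ([twins_exist]). Two families then overlap cell by cell,
    and the events attached to different pairs of cells are independent. For two cells, the
    probability that both families are good there exceeds the product of the two probabilities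
    by a factor at most h * h', where h is 5 / 3 for a cell in which the families choose the same
    pair and 1 otherwise; this is a finite computation ([both_uniform_count]). So no penalty is
    needed for sharing a single vertex, and the bound factors over the cells: the second moment
    divided by the squared mean is at most (1 + (5 / 3) ^ (m + 1) / N ^ 2) ^ m for sides of size N.
    As (5 / 3) ^ m <= 2 ^ (3 m / 4), this tends to 1 for m near (9 / 4) log2 n and N near n / (2 m).

    The independence number is bounded by 2 log2 n through the first moment
    ([avg_misses_log]). Hence c = 1 / 8 works. *)

(** * Decompositions from classes of vertices *)

Section BicliquesFromClasses.
Variables (T : finType) (G : sgraph T).

Lemma adjC x y : adj G x y = adj G y x.
Proof. by rewrite /adj setUC. Qed.

Lemma adj_neq x y : adj G x y -> x != y.
Proof.
move=> xyG; have /forall_inP/(_ _ xyG) := edgesP G.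
by rewrite cards2; case: (x != y).
Qed.

Lemma edge_adj e : e \in edges G -> exists x y, e = [set x; y] /\ adj G x y.
Proof.
move=> eG; have /forall_inP/(_ _ eG)/cards2P[x [y [_ eE]]] := edgesP G.
by exists x, y; rewrite /adj -eE.
Qed.

Lemma set2_eq (S : finType) (a b c d : S) :
  [set a; b] = [set c; d] -> (a = c /\ b = d) \/ (a = d /\ b = c).
Proof.
move/setP => E; move: (E a) (E b) (E c) (E d).
rewrite !inE !eqxx ?orbT /= ![c == _]eq_sym ![d == _]eq_sym => Ea Eb Ec Ed.
have /orP[/andP[/eqP-> /eqP->]|/andP[/eqP-> /eqP->]] :
    (a == c) && (b == d) || (a == d) && (b == c); [|by left|by right].
by move: Ea Eb Ec Ed; do 4!case: (_ == _).
Qed.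

Lemma bc_le_card (P : {set {set {set T}}}) :
  biclique_partition G P -> bc G <= #|P|.
Proof.
move=> PP; rewrite /bc; case: ex_minnP => k _; apply.
by apply/existsP; exists P; rewrite PP eqxx.
Qed.

(** The vertices are grouped into the fibres of r. Every class owns one biclique, and every
    edge is put into the biclique of one of the two classes that it meets. *)
Variable (r : T -> T).

Definition uniform_to (i j : T) :=
  [forall b, (r b == j) ==>
    [forall a, (r a == i) ==> [forall a', (r a' == i) ==> (adj G a b == adj G a' b)]]].

Hypothesis class_indep : forall a b, r a = r b -> ~~ adj G a b.
Hypothesis class_unif : forall i j,
  i \in codom r -> j \in codom r -> i != j -> uniform_to i j || uniform_to j i.

(* Which of two classes takes the edges between them; ties are broken by a fixed order of T. *)
Let owner i j :=
  uniform_to i j && (~~ uniform_to j i || (enum_rank i < enum_rank j)).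

Let owner_total i j : i \in codom r -> j \in codom r -> i != j ->
  owner i j || owner j i.
Proof.
move=> ri rj ij; have := class_unif ri rj ij; rewrite /owner.
case: (uniform_to i j) (uniform_to j i) => [] [] //= _.
by rewrite -neq_ltn; apply: contra ij => /eqP/val_inj/enum_rank_inj->.
Qed.

Let owner_anti i j : owner i j -> owner j i -> False.
Proof.
rewrite /owner => /andP[ij lt1] /andP[ji lt2]; move: lt1 lt2.
by rewrite ij ji /= => lt1; rewrite ltnNge ltnW.
Qed.

Let class i := [set a | r a == i].
Let across i := [set b | [&& r b != i, owner i (r b) & [forall a in class i, adj G a b]]].
Let F i := cross_edges (class i) (across i).

Let F_mem i a b : r a = i -> owner i (r b) -> r a != r b -> adj G a b ->
  [set a; b] \in F i.
Proof.
move=> ra o rab ab; apply: imset2_f; rewrite !inE ?ra //.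
rewrite -ra eq_sym rab ra o; apply/forall_inP => c; rewrite inE => rc.
case/andP: o => /forallP/(_ b); rewrite eqxx /= => /forallP/(_ a).
by rewrite ra eqxx => /forallP/(_ c); rewrite rc => /eqP <-.
Qed.

(** If class i is uniform to the vertices of the classes it owns, then the edges it takes join
    every vertex of class i to every vertex of a fixed set, so they form a biclique. *)
Lemma bc_le_classes : bc G <= #|codom r|.
Proof.
pose P := [set F i | i in codom r] :\ set0.
apply: (@leq_trans #|P|); last first.
  by rewrite (leq_trans _ (leq_imset_card F _)) // subset_leq_card // subD1set.
have F_edge i e : e \in F i -> exists a b,
   [/\ e = [set a; b], r a = i, owner i (r b) & adj G a b].
  case/imset2P => a b; rewrite !inE => /eqP ra /and3P[rb o /forall_inP ab] ->.
  by exists a, b; split=> //; apply: ab; rewrite inE ra.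
apply: bc_le_card; apply/andP; split; first apply/and3P; first split.
- apply/eqP/setP => e; apply/bigcupP/idP.
    case=> Q /setD1P[_ /imsetP[i _ ->]] /F_edge[a [b [-> _ _]]]; exact.
  move=> /edge_adj[a [b [-> ab]]].
  have rab : r a != r b by apply: contraL ab => /eqP/class_indep.
  have key c d : r c != r d -> owner (r c) (r d) -> adj G c d ->
      exists2 Q, Q \in P & [set c; d] \in Q.
    move=> rcd o cd; exists (F (r c)); last exact: F_mem.
    rewrite !inE imset_f ?codom_f // andbT; apply/set0Pn.
    by exists [set c; d]; apply: F_mem.
  have /orP[o|o] := owner_total (codom_f r a) (codom_f r b) rab.
    exact: key.
  by rewrite setUC; apply: key => //; rewrite 1?eq_sym 1?adjC.
- apply/trivIsetP => _ _ /setD1P[_ /imsetP[i _ ->]] /setD1P[_ /imsetP[j _ ->]] ij.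
  apply/pred0P => e /=; apply/negP => /andP[/F_edge[a [b [-> ra ob ab]]]].
  move=> /F_edge[c [d [/set2_eq[[? ?]|[? ?]] rc od cd]]]; subst.
    by rewrite eqxx in ij.
  exact: owner_anti ob od.
- by rewrite !inE eqxx.
apply/forall_inP => Q /setD1P[Q0 /imsetP[i _ QE]]; apply/andP; split.
  by apply/subsetP => e; rewrite QE => /F_edge[a [b [-> _ _]]]; exact.
have [e] := set0Pn _ Q0; rewrite QE => /imset2P[a b ai bi _].
apply/existsP; exists (class i); apply/existsP; exists (across i).
apply/and4P; split; [by apply/set0Pn; exists a|by apply/set0Pn; exists b| |by []].
by apply/pred0P => c; rewrite /= !inE; case: (r c == i).
Qed.

End BicliquesFromClasses.

(** Pairs of twins are the two-vertex classes; all other vertices are classes of their own. *)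
Section Twins.
Variables (T : finType) (G : sgraph T) (m : nat).

(** The four adjacencies between pairs {x, y} and {u, v} are such that one pair is uniform to
    each vertex of the other; 6 of the 16 patterns qualify. *)
Definition uniform4 (xu xv yu yv : bool) : bool :=
  (xu == yu) && (xv == yv) || (xu == xv) && (yu == yv).

Variable z : 'I_m * bool -> T.
Hypothesis z_inj : injective z.
Hypothesis z_pair : forall i, ~~ adj G (z (i, false)) (z (i, true)).
Hypothesis z_unif : forall i j : 'I_m, i < j ->
  uniform4 (adj G (z (i, false)) (z (j, false))) (adj G (z (i, false)) (z (j, true)))
           (adj G (z (i, true)) (z (j, false))) (adj G (z (i, true)) (z (j, true))).

(* The first twin of each pair represents its class. *)
Let r a := if [pick i | z (i, true) == a] is Some i then z (i, false) else a.

Let rz i b : r (z (i, b)) = z (i, false).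
Proof.
rewrite /r; case: pickP => [j /eqP/z_inj[->//]|/(_ i)].
by case: b => //; rewrite eqxx.
Qed.

Let r_fibre a : (exists i b, a = z (i, b)) \/
   (r a = a /\ forall c, r c = a -> c = a).
Proof.
case: (pickP (fun p => z p == a)) => [[i b] /eqP<-|no]; first by left; exists i, b.
right; split.
  by rewrite /r; case: pickP => // i; rewrite no.
by move=> c; rewrite /r; case: pickP => // i _ /eqP; rewrite no.
Qed.

Let rz_inv a i : r a = z (i, false) -> exists b, a = z (i, b).
Proof.
rewrite /r; case: pickP => [j /eqP<- /z_inj[->]|_ ->]; first by exists true.
by exists false.
Qed.

Lemma bc_le_twins : bc G + m <= #|T|.
Proof.
have single i j : (forall a, r a = i -> a = i) -> uniform_to G r i j.
  move=> si; apply/forallP => b; apply/implyP => _; apply/forallP => a.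
  apply/implyP => /eqP/si->; apply/forallP => a'; apply/implyP => /eqP/si->.
  exact: eqxx.
have pairs (i j : 'I_m) : i < j -> uniform_to G r (z (i, false)) (z (j, false))
                       || uniform_to G r (z (j, false)) (z (i, false)).
  move=> /z_unif/orP[]/andP[/eqP E1 /eqP E2]; apply/orP; [left|right].
    apply/forallP => b; apply/implyP => /eqP/rz_inv[{b}b ->].
    apply/forallP => c; apply/implyP => /eqP/rz_inv[{c}c ->].
    apply/forallP => d; apply/implyP => /eqP/rz_inv[{d}d ->].
    by case: b c d => [] [] []; rewrite ?E1 ?E2.
  apply/forallP => b; apply/implyP => /eqP/rz_inv[{b}b ->].
  apply/forallP => c; apply/implyP => /eqP/rz_inv[{c}c ->].
  apply/forallP => d; apply/implyP => /eqP/rz_inv[{d}d ->].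
  rewrite ![adj G _ (z (i, b))]adjC.
  by case: b c d => [] [] []; rewrite ?E1 ?E2.
have bcr : bc G <= #|codom r|.
  apply: bc_le_classes => [a b|u v].
    case: (r_fibre a) => [[i [c ->]]|[ra fa]].
      rewrite rz => /esym/rz_inv[d ->].
      have /negbTE nzi := z_pair i.
      case: c d => [] []; rewrite 1?[adj _ _ (z (i, false))]adjC ?nzi //;
        by apply/negP => /adj_neq; rewrite eqxx.
    by rewrite ra => /esym/fa->; apply/negP => /adj_neq; rewrite eqxx.
  move=> /codomP[a ->] /codomP[b ->].
  case: (r_fibre a) => [[i [c ->]]|[ra fa] _]; last by rewrite ra single.
  case: (r_fibre b) => [[j [d ->]]|[rb fb] _]; last by rewrite rb orbC single.
  rewrite !rz => ij; case: (ltngtP (i : nat) j) => [lt_ij|lt_ji|/val_inj E].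
  - exact: pairs.
  - by rewrite orbC; exact: pairs.
  by rewrite E eqxx in ij.
apply: (leq_trans (leq_add bcr (leqnn m))).
have zT : #|[set z (i, true) | i : 'I_m]| = m.
  by rewrite card_imset ?card_ord // => i j /z_inj[].
rewrite -[X in _ + X]zT -(cardsC [set z (i, true) | i : 'I_m]) addnC leq_add2l.
apply: subset_leq_card; apply/subsetP => _ /codomP[a ->].
rewrite !inE; apply/imsetP => -[i _]; rewrite /r; case: pickP => [j _ /z_inj//|no E].
by move: (no i); rewrite E eqxx.
Qed.

End Twins.

(** * Uniform random subsets *)

Import Order.TTheory GRing.Theory Num.Theory.
Local Open Scope ring_scope.

Section RandomSubset.
Variables (R : realFieldType) (U : finType) (D : {set U}).
Implicit Types (f g : {set U} -> R) (A B w : {set U}).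

Definition avg f : R := (\sum_(w in powerset D) f w) / 2 ^+ #|D|.

Definition depends_on A f := forall w w', w :&: A = w' :&: A -> f w = f w'.

Lemma eq_avg f g : (forall w, w \subset D -> f w = g w) -> avg f = avg g.
Proof.
by move=> fg; rewrite /avg; congr (_ / _); apply: eq_bigr => w; rewrite inE => /fg.
Qed.

Lemma avg_le f g : (forall w, w \subset D -> f w <= g w) -> avg f <= avg g.
Proof.
move=> fg; rewrite ler_wpM2r ?invr_ge0 ?exprn_ge0 //.
by apply: ler_sum => w; rewrite inE => /fg.
Qed.

Lemma avg_sum (I : finType) (P : pred I) (F : I -> {set U} -> R) :
  avg (fun w => \sum_(i | P i) F i w) = \sum_(i | P i) avg (F i).
Proof. by rewrite /avg exchange_big /= mulr_suml. Qed.

Lemma avgD f g : avg (fun w => f w + g w) = avg f + avg g.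
Proof. by rewrite /avg big_split mulrDl. Qed.

Lemma avgZ c f : avg (fun w => c * f w) = c * avg f.
Proof. by rewrite /avg -mulr_sumr mulrA. Qed.

Lemma avg_cst c : avg (fun=> c) = c.
Proof.
rewrite /avg big_const iter_addr_0 card_powerset -[c *+ _]mulr_natr natrX mulfK //.
by rewrite expf_neq0 // pnatr_eq0.
Qed.

(** Independence on disjoint sets of coordinates: exchanging the parts outside A of two
    independent samples is a measure-preserving involution, which turns f w * g w' into
    f w * g w. *)
Lemma avg_indep A f g : depends_on A f -> depends_on (~: A) g ->
  avg (fun w => f w * g w) = avg f * avg g.
Proof.
move=> fA gA.
pose mix w w' := (w :&: A) :|: (w' :&: ~: A).
pose swap (p : {set U} * {set U}) := (mix p.1 p.2, mix p.2 p.1).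
have mixA w w' : mix w w' :&: A = w :&: A.
  by apply/setP => x; rewrite !inE; case: (x \in A); rewrite ?andbF ?andbT ?orbF.
have mixCA w w' : mix w w' :&: ~: A = w' :&: ~: A.
  by apply/setP => x; rewrite !inE; case: (x \in A); rewrite ?andbF ?andbT ?orbF.
have swapK : involutive swap.
  case=> w w'; congr pair; apply/setP => x; rewrite !inE;
  by case: (x \in A); rewrite ?andbF ?andbT ?orbF.
have mixD w w' : w \subset D -> w' \subset D -> mix w w' \subset D.
  by move=> wD w'D; rewrite subUset !(subset_trans (subsetIl _ _)).
have E : (\sum_(w in powerset D) f w) * (\sum_(w in powerset D) g w) =
         (\sum_(w in powerset D) f w * g w) * 2 ^+ #|D|.
  rewrite big_distrlr /= pair_big /= (reindex_inj (inv_inj swapK)) /=.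
  transitivity (\sum_(p : {set U} * {set U} | (p.1 \in powerset D) && (p.2 \in powerset D))
      f p.1 * g p.1).
    apply: eq_big => [p|p _] /=; last first.
      by rewrite (fA _ p.1 (mixA _ _)) (gA _ p.1 (mixCA _ _)).
    rewrite !inE; apply/andP/andP => -[p1 p2]; last by split; apply: mixD.
    by split; [rewrite -[p.1](congr1 fst (swapK p))|rewrite -[p.2](congr1 snd (swapK p))];
      apply: mixD.
  rewrite -(pair_big (mem (powerset D)) (mem (powerset D)) (fun w _ => f w * g w)) /=.
  rewrite mulr_suml; apply: eq_bigr => w _.
  by rewrite big_const iter_addr_0 card_powerset -[_ *+ _]mulr_natr natrX.
rewrite /avg mulrACA E -mulrA mulVKf //.
by rewrite expf_neq0 // pnatr_eq0.
Qed.

Lemma depends_onW A B f : A \subset B -> depends_on A f -> depends_on B f.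
Proof.
by move=> /setIidPr <- fA w w' E; apply: fA; rewrite !setIA E.
Qed.

Lemma avg_prod_seq (I : eqType) (s : seq I) (A : I -> {set U}) (F : I -> {set U} -> R) :
  uniq s -> (forall i, i \in s -> depends_on (A i) (F i)) ->
  (forall i j, i \in s -> j \in s -> i != j -> [disjoint A i & A j]) ->
  avg (fun w => \prod_(i <- s) F i w) = \prod_(i <- s) avg (F i).
Proof.
elim: s => [|i s IHs] /=.
  by move=> *; rewrite big_nil -[RHS]avg_cst; apply: eq_avg => w _; rewrite big_nil.
move=> /andP[is_ us] dep dis; rewrite big_cons -IHs //; last 2 first.
- by move=> j js; apply: dep; rewrite inE js orbT.
- by move=> j k js ks; apply: dis; rewrite inE ?js ?ks orbT.
rewrite -(@avg_indep (A i)).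
- by apply: eq_avg => w _; rewrite big_cons.
- by apply: dep; rewrite mem_head.
move=> w w' E; apply: eq_big_seq => j js.
apply: (depends_onW _ (dep j _)) E; last by rewrite inE js orbT.
rewrite -disjoints_subset dis ?mem_head // ?inE ?js ?orbT //.
by apply: contraNneq is_ => <-.
Qed.

Lemma avg_prod (I : finType) (P : pred I) (A : I -> {set U}) (F : I -> {set U} -> R) :
  (forall i, P i -> depends_on (A i) (F i)) ->
  (forall i j, P i -> P j -> i != j -> [disjoint A i & A j]) ->
  avg (fun w => \prod_(i | P i) F i w) = \prod_(i | P i) avg (F i).
Proof.
move=> dep dis; rewrite -big_filter -(avg_prod_seq (A := A)) ?filter_uniq ?index_enum_uniq //.
- by apply: eq_avg => w _; rewrite big_filter.
- by move=> i; rewrite mem_filter => /andP[/dep].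
by move=> i j; rewrite !mem_filter => /andP[Pi _] /andP[Pj _]; apply: dis.
Qed.

Lemma avg_mem e b : e \in D -> avg (fun w => ((e \in w) == b)%:R) = 2^-1.
Proof.
move=> eD.
have sym c : avg (fun w => ((e \in w) == c)%:R) = avg (fun w => ((e \in w) == ~~ c)%:R).
  pose flip w := if e \in w then w :\ e else e |: w.
  have flip_e w : (e \in flip w) = (e \notin w).
    by rewrite /flip; case: ifP; rewrite !inE eqxx.
  have flipK : involutive flip.
    move=> w; rewrite {1}/flip flip_e.
    by case ew: (e \in w); rewrite /flip ew /=; [rewrite setD1K|rewrite setU1K ?ew].
  rewrite /avg (reindex_inj (inv_inj flipK)) /=; congr (_ / _).
  apply: eq_big => [w|w _]; last by rewrite flip_e; case: (_ \in _); case: c.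
  rewrite !inE /flip; case: ifP => ew; last by rewrite subUset sub1set eD.
  apply/idP/idP => h; last exact: subset_trans (subD1set _ _) h.
  by rewrite -(setD1K ew) subUset sub1set eD.
have := avg_cst 1.
rewrite (eq_avg (g := fun w => ((e \in w) == b)%:R + ((e \in w) == ~~ b)%:R)); last first.
  by move=> w _; case: (_ \in _); case: b; rewrite /= ?addr0 ?add0r.
by rewrite avgD -sym; lra.
Qed.

(** The number of bit strings of length k that satisfy p, in a form that computes. *)
Fixpoint count_bits k (p : seq bool -> bool) : nat :=
  if k is k'.+1 then
    (count_bits k' (fun bs => p (true :: bs)) + count_bits k' (fun bs => p (false :: bs)))%N
  else p [::].

Lemma avg_bits s (p : seq bool -> bool) : uniq s -> {subset s <= D} ->
  avg (fun w => (p [seq e \in w | e <- s])%:R) = (count_bits (size s) p)%:R / 2 ^+ size s.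
Proof.
elim: s p => [|e s IHs] p; first by rewrite /= avg_cst expr0 divr1.
move=> /= /andP[es us] sD.
have eD : e \in D by apply: sD; rewrite mem_head.
have sD' : {subset s <= D} by move=> x xs; apply: sD; rewrite inE xs orbT.
have split_e b : avg (fun w => ((e \in w) == b)%:R * (p (b :: [seq e \in w | e <- s]))%:R)
   = 2^-1 * ((count_bits (size s) (fun bs => p (b :: bs)))%:R / 2 ^+ size s).
  rewrite (@avg_indep [set e]).
  - by rewrite avg_mem // (IHs (fun bs => p (b :: bs))).
  - by move=> w w' /setP/(_ e); rewrite !inE eqxx !andbT => ->.
  - move=> w w' /setP E; congr (p (_ :: _))%:R; apply/eq_in_map => x xs.
  have := E x; rewrite !inE.
  by have -> : x != e by [apply: contraNneq es => <-]; rewrite !andbT.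
rewrite (eq_avg (g := fun w => ((e \in w) == true)%:R * (p (true :: [seq e \in w | e <- s]))%:R
  + ((e \in w) == false)%:R * (p (false :: [seq e \in w | e <- s]))%:R)); last first.
  by move=> w _; case: (e \in w); rewrite mul1r mul0r ?addr0 ?add0r.
rewrite avgD !split_e -mulrDr -mulrDl -natrD exprS invfM.
by rewrite mulrCA.
Qed.

(** The inequality of Cauchy and Schwarz, from the pointwise bound 2 t X - (t X) ^ 2 <= 1 (X != 0)
    at the value of t that is best for the given bound on the second moment. *)
Lemma second_moment (X : {set U} -> R) (B : R) :
  0 < B -> avg (fun w => X w ^+ 2) <= B ->
  avg X ^+ 2 / B <= avg (fun w => (X w != 0)%:R).
Proof.
move=> B0 XB; pose t := avg X / B.
apply: (@le_trans _ _ (2 * t * avg X + - t ^+ 2 * avg (fun w => X w ^+ 2))).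
  apply: (@le_trans _ _ (2 * t * avg X + - t ^+ 2 * B)).
    by rewrite /t le_eqVlt; apply/orP; left; apply/eqP; field; rewrite gt_eqF.
  by rewrite lerD2l ler_wnM2l // oppr_le0 sqr_ge0.
rewrite -!avgZ -avgD; apply: avg_le => w _.
have [->|_] := eqVneq (X w) 0; first by rewrite expr0n !mulr0 addr0.
rewrite -subr_ge0 /=.
have -> : 1 - (2 * t * X w + - t ^+ 2 * X w ^+ 2) = (1 - t * X w) ^+ 2.
  ring.
exact: sqr_ge0.
Qed.

Lemma avg_disjoint (S : {set U}) : S \subset D ->
  avg (fun w => [disjoint w & S]%:R) = 2 ^- #|S|.
Proof.
move=> SE; rewrite /avg.
have -> : \sum_(w in powerset D) [disjoint w & S]%:R = \sum_(w in powerset (D :\: S)) 1 :> R.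
  rewrite big_mkcond [RHS]big_mkcond; apply: eq_bigr => w _.
  by rewrite !inE subsetD; case: (w \subset D); case: [disjoint w & S].
rewrite sumr_const card_powerset natrX -(cardsID S D) (setIidPr SE) exprD.
by rewrite invfM mulrCA divff ?mulr1 // expf_neq0 // pnatr_eq0.
Qed.

End RandomSubset.

(** * Counting patterns of adjacencies *)

Definition two_sets (T : finType) : {set {set T}} := [set e : {set T} | #|e| == 2%N].

(** Two choices (x, y) and (x', y') of twins in the same cell are listed without repetition
    as x, y followed by those of x', y' that are new. A code (s, k, k') records the length s of
    that list and the positions of x' and y' in it; these are all the possible codes, as x and
    y' (or x' and y) never coincide. *)
Definition overlap_codes : seq (nat * nat * nat) :=
  [:: (2, 0, 1); (3, 2, 1); (3, 0, 2); (4, 2, 3)]%N.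

(** A slot is a pair of vertices, seen as a possible edge. These are the slots, as pairs of
    positions in two such lists, that matter for two choices in each of two cells. *)
Definition slot_positions (k k' l l' : nat) : seq (nat * nat) :=
  undup [:: (0, 0); (0, 1); (1, 0); (1, 1); (k, l); (k, l'); (k', l); (k', l')]%N.

Definition both_uniform (k k' l l' : nat) (bs : seq bool) : bool :=
  let bit p q := nth false bs (index (p, q) (slot_positions k k' l l')) in
  uniform4 (bit 0 0) (bit 0 1) (bit 1 0) (bit 1 1) &&
  uniform4 (bit k l) (bit k l') (bit k' l) (bit k' l').

(** Three times the penalty 5/3 (equal choices) or 1 (otherwise), so as to be an integer. *)
Definition overlap_factor s : nat := if s == 2%N then 5 else 3.

(** The numerical core of the second moment: two choices in each of two cells are both uniform
    with probability at most 9/64, the value under independence, times the penalties of the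
    two cells. When neither cell repeats its choice at most one slot is shared and equality
    holds; when both do, 3/8 = 24/64 is to be compared with 9/64 * 25/9 = 25/64. *)
Lemma both_uniform_count : all (fun c => all (fun c' =>
    let P := slot_positions c.1.2 c.2 c'.1.2 c'.2 in
    count_bits (size P) (both_uniform c.1.2 c.2 c'.1.2 c'.2) * 64
    <= 2 ^ size P * (overlap_factor c.1.1 * overlap_factor c'.1.1))%N
  overlap_codes) overlap_codes.
Proof. by vm_compute. Qed.

Lemma bernoulli (R : realFieldType) (t : R) k : 0 <= t <= 1 -> 1 - k%:R * t <= (1 - t) ^+ k.
Proof.
move=> /andP[t0 t1]; elim: k => [|k IHk]; first by rewrite mul0r subr0.
rewrite exprS; apply: (@le_trans _ _ ((1 - t) * (1 - k%:R * t))).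
  rewrite -natr1 -subr_ge0.
  have -> : (1 - t) * (1 - k%:R * t) - (1 - (k%:R + 1) * t) = k%:R * t ^+ 2 by ring.
  by rewrite mulr_ge0 ?sqr_ge0.
by rewrite ler_wpM2l // subr_ge0.
Qed.

(** * Second moment of the number of good selections of twins

    The vertices v (i, b, k) form m cells, each cell having two sides b with N vertices. A
    selection picks one vertex on either side of every cell. *)

Section TwinFamilies.
Variables (R : realFieldType) (T : finType) (m N : nat).
Variable v : 'I_m * bool * 'I_N -> T.
Hypothesis v_inj : injective v.
Local Notation D := (two_sets T).
Local Notation choice := ('I_N * 'I_N)%type.

Definition twin i (a : choice) (b : bool) : T := v (i, b, if b then a.2 else a.1).

(** A good diagonal block (i, i) says that the two twins of cell i are not adjacent. *)
Definition good i j (a a' : choice) (w : {set {set T}}) : bool :=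
  if i == j then [set twin i a false; twin i a true] \notin w
  else uniform4 ([set twin i a false; twin j a' false] \in w)
                ([set twin i a false; twin j a' true] \in w)
                ([set twin i a true; twin j a' false] \in w)
                ([set twin i a true; twin j a' true] \in w).

(** All slots with one end in cell i and the other in cell j, found by pulling a slot back
    along v and reading off the cells of its ends. Indexing by the set {i, j} makes blocks of
    different unordered pairs disjoint by construction. *)
Definition block i j : {set {set T}} :=
  [set e : {set T} | [set p.1.1 | p in v @^-1: e] == [set i; j]].

Definition cell i : {set T} := [set v (i, c.1, c.2) | c : bool * 'I_N].

Definition overlap_weight (a b : choice) : R := if a == b then 5 / 3 else 1.

Lemma mem_block i j b b' k k' : [set v (i, b, k); v (j, b', k')] \in block i j.
Proof.
rewrite inE; apply/eqP.
have -> : v @^-1: [set v (i, b, k); v (j, b', k')] = [set (i, b, k); (j, b', k')].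
  by apply/setP => p; rewrite !inE !(inj_eq v_inj).
by rewrite imsetU1 imset_set1.
Qed.

Lemma block_disjoint (i j i' j' : 'I_m) : (i <= j)%N -> (i' <= j')%N ->
  (i, j) != (i', j') -> [disjoint block i j & block i' j'].
Proof.
move=> ij ij' neq; apply/pred0P => e /=; apply/negP => /andP[]; rewrite !inE.
move=> /eqP-> /eqP/set2_eq[[ei ej]|[ei ej]]; subst; first by rewrite eqxx in neq.
have E : i' = j' by apply/val_inj/anti_leq/andP.
by rewrite E eqxx in neq.
Qed.

Lemma good_depends i j a a' :
  depends_on (block i j) (fun w => (good i j a a' w)%:R : R).
Proof.
move=> w w' /setP E; congr (_%:R).
have in_w b b' k k' : ([set v (i, b, k); v (j, b', k')] \in w) =
                      ([set v (i, b, k); v (j, b', k')] \in w').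
  by have := E [set v (i, b, k); v (j, b', k')]; rewrite !in_setI mem_block !andbT.
rewrite /good; case: eqP => [eij|_]; last by rewrite /twin !in_w.
by subst j; rewrite /twin !in_w.
Qed.

Lemma slot_two_sets p q : p != q -> [set v p; v q] \in D.
Proof. by move=> pq; rewrite inE cards2 (inj_eq v_inj) pq. Qed.

(** Two choices in one cell, merged into a list L as described by the codes; the default value
    x0 is also the first element of L. *)
Lemma overlapP i (a b : choice) (x0 := twin i a false) : exists L k k',
  [/\ uniq L /\ {subset L <= cell i},
      (size L, k, k') \in overlap_codes,
      nth x0 L 0 = twin i a false /\ nth x0 L 1 = twin i a true,
      nth x0 L k = twin i b false /\ nth x0 L k' = twin i b true
    & (size L == 2%N) = (a == b)].
Proof.
have tw c e : twin i c e \in cell i.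
  by apply/imsetP; exists (e, if e then c.2 else c.1).
have twE c e c' e' : (twin i c e == twin i c' e') =
    (e == e') && (if e then c.2 == c'.2 else c.1 == c'.1).
  rewrite (inj_eq v_inj) !xpair_eqE eqxx /=; case: eqP => [->|//].
  by case: e'.
have sub2 s : all (fun x => x \in cell i) s -> {subset s <= cell i} by move=> /allP.
case: (a) (b) => [a1 a2] [b1 b2].
have [E1|N1] := eqVneq a1 b1; have [E2|N2] := eqVneq a2 b2; subst.
- exists [:: twin i (b1, b2) false; twin i (b1, b2) true], 0%N, 1%N.
  by split=> //; [split; [rewrite /= !inE twE|apply: sub2; rewrite /= !tw] | rewrite eqxx].
- exists [:: twin i (b1, a2) false; twin i (b1, a2) true; twin i (b1, b2) true], 0%N, 2%N.
  by split=> //; [split; [rewrite /= !inE !twE /= N2|apply: sub2; rewrite /= !tw] |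
    rewrite xpair_eqE (negbTE N2) andbF].
- exists [:: twin i (a1, b2) false; twin i (a1, b2) true; twin i (b1, b2) false], 2%N, 1%N.
  by split=> //; [split; [rewrite /= !inE !twE /= N1|apply: sub2; rewrite /= !tw] |
    rewrite xpair_eqE (negbTE N1)].
exists [:: twin i (a1, a2) false; twin i (a1, a2) true; twin i (b1, b2) false;
           twin i (b1, b2) true], 2%N, 3%N.
by split=> //; [split; [rewrite /= !inE !twE /= (negbTE N1) (negbTE N2)|
  apply: sub2; rewrite /= !tw] |
    rewrite xpair_eqE (negbTE N1)].
Qed.

Lemma grid_slots i j L L' x0 y0 P : i != j -> uniq L -> uniq L' ->
  {subset L <= cell i} -> {subset L' <= cell j} ->
  uniq P -> (forall p, p \in P -> (p.1 < size L)%N && (p.2 < size L')%N) ->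
  let s := [seq [set nth x0 L p.1; nth y0 L' p.2] | p <- P] in uniq s /\ {subset s <= D}.
Proof.
move=> ij uL uL' Li Lj uP bP; have in_bounds p : p \in P ->
    nth x0 L p.1 \in cell i /\ nth y0 L' p.2 \in cell j.
  by move=> /bP/andP[p1 p2]; split; [apply/Li/mem_nth|apply/Lj/mem_nth].
have cells_disjoint x : x \in cell i -> x \in cell j -> False.
  move=> /imsetP[c _ ->] /imsetP[d _ /v_inj[E]].
  by move: ij; rewrite E eqxx.
split.
  rewrite map_inj_in_uniq // => -[p q] [p' q'] pP p'P /set2_eq[[]|[E _]].
    have /andP[/= p1 p2] := bP _ pP; have /andP[/= p1' p2'] := bP _ p'P.
    by move=> /eqP; rewrite nth_uniq // => /eqP-> /eqP; rewrite nth_uniq // => /eqP->.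
  by have [/cells_disjoint + _] := in_bounds _ pP; rewrite E => /(_ (in_bounds _ p'P).2).
move=> e /mapP[p /in_bounds[/imsetP[c _ ->] /imsetP[d _ ->]] ->].
by apply: slot_two_sets; rewrite !xpair_eqE negb_and negb_and ij.
Qed.

(** Both events depend only on the slots at the positions listed for the codes of the two
    overlaps. These slots are distinct, so that their bits are uniform and independent, and the
    probability is the fraction counted in advance. *)
Lemma avg_good_good_cross i j a a' b b' : i != j ->
  avg D (fun w => (good i j a a' w)%:R * (good i j b b' w)%:R)
  <= (3 / 8) ^+ 2 * (overlap_weight a b * overlap_weight a' b') :> R.
Proof.
move=> ij.
have [L [k [k' [[uL Li] cL [L0 L1] [Lk Lk'] szL]]]] := overlapP i a b.
have [L' [l [l' [[uL' Lj] cL' [L0' L1'] [Ll Ll'] szL']]]] := overlapP j a' b'.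
pose x0 := twin i a false; pose y0 := twin j a' false.
pose P := slot_positions k k' l l'.
have bounds (K : seq T) n n' : (size K, n, n') \in overlap_codes ->
    [/\ (0 < size K)%N, (1 < size K)%N, (n < size K)%N & (n' < size K)%N].
  by rewrite !inE !xpair_eqE => /or4P[] /andP[/andP[/eqP-> /eqP->] /eqP->].
have [b0 b1 bk bk'] := bounds _ _ _ cL; have [b0' b1' bl bl'] := bounds _ _ _ cL'.
have P_bounds p : p \in P -> (p.1 < size L)%N && (p.2 < size L')%N.
  rewrite mem_undup => /(allP (_ : all (fun p => (p.1 < _) && (p.2 < _))%N _)); apply.
  by rewrite /= b0 b1 bk bk' b0' b1' bl bl'.
have [us sD] := grid_slots x0 y0 ij uL uL' Li Lj (undup_uniq _) P_bounds.
set s := [seq [set nth x0 L p.1; nth y0 L' p.2] | p <- _] in us sD.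
have bitE (w : {set {set T}}) p q : (p, q) \in P ->
    nth false [seq e \in w | e <- s] (index (p, q) P) = ([set nth x0 L p; nth y0 L' q] \in w).
  move=> pqP; rewrite (nth_map set0) ?size_map ?index_mem //.
  by rewrite (nth_map (0, 0)%N) ?index_mem // nth_index.
rewrite (@eq_avg _ _ _ _ (fun w =>
    (both_uniform k k' l l' [seq e \in w | e <- s])%:R)); last first.
  move=> w _; rewrite -natrM mulnb /both_uniform !bitE;
    rewrite ?mem_undup ?inE ?eqxx ?orbT //.
  by rewrite /x0 /y0 L0 L1 L0' L1' Lk Lk' Ll Ll' /good (negbTE ij).
rewrite avg_bits // size_map.
have /allP/(_ _ cL)/allP/(_ _ cL') := both_uniform_count.
cbv beta zeta iota delta [fst snd]; rewrite -/P.
rewrite -(ler_nat R) !natrM natrX => le_count.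
rewrite ler_pdivrMr ?exprn_gt0 //.
have wE (K : seq T) (c c' : choice) :
    (size K == 2%N) = (c == c') ->
    (overlap_factor (size K))%:R = 3 * overlap_weight c c' :> R.
  rewrite /overlap_factor /overlap_weight => ->; case: ifP => _; lra.
move: le_count; rewrite (wE L a b) // (wE L' a' b') //.
set A := _%:R; set Q := 2 ^+ _; set wa := overlap_weight a b; set wb := overlap_weight _ _.
by move=> le_count; nra.
Qed.

Lemma avg_good_cross i j a a' : i != j ->
  avg D (fun w => (good i j a a' w)%:R) = 3 / 8 :> R.
Proof.
move=> ij; pose L := [:: twin i a false; twin i a true].
pose L' := [:: twin j a' false; twin j a' true].
have uL k c : uniq [:: twin k c false; twin k c true].
  by rewrite /= inE (inj_eq v_inj) !xpair_eqE andbF.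
have Lk k c : {subset [:: twin k c false; twin k c true] <= cell k}.
  move=> x; rewrite !inE => /orP[]/eqP->; apply/imsetP.
    by exists (false, c.1).
  by exists (true, c.2).
pose P := [:: (0, 0); (0, 1); (1, 0); (1, 1)]%N.
have P_bounds p : p \in P -> (p.1 < size L)%N && (p.2 < size L')%N.
  by rewrite !inE => /or4P[]/eqP->.
have [us sD] := grid_slots (twin i a false) (twin j a' false) ij (uL i a) (uL j a')
  (Lk i a) (Lk j a') (isT : uniq P) P_bounds.
pose p bs := uniform4 (nth false bs 0) (nth false bs 1) (nth false bs 2) (nth false bs 3).
rewrite (@eq_avg _ _ _ _ (fun w => (p [seq e \in w | e <- [seq
    [set nth (twin i a false) L p.1; nth (twin j a' false) L' p.2] | p <- P]])%:R)); last first.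
  by move=> w _; rewrite /good (negbTE ij).
by rewrite avg_bits //=; lra.
Qed.

Lemma twin_slot_in i a : [set twin i a false; twin i a true] \in D.
Proof. by apply: slot_two_sets; rewrite !xpair_eqE andbF. Qed.

Lemma avg_good_diag i a a' : avg D (fun w => (good i i a a' w)%:R) = 1 / 2 :> R.
Proof.
rewrite -(avg_mem R false (twin_slot_in i a)) mul1r.
by apply: eq_avg => w _; rewrite /good eqxx eqbF_neg.
Qed.

(** Nonadjacency of two equal pairs costs a factor 2 over independence, covered by the
    penalty (5 / 3) ^ 2; this lets the diagonal blocks be treated like the others. *)
Lemma avg_good_good_diag i a a' b b' :
  avg D (fun w => (good i i a a' w)%:R * (good i i b b' w)%:R)
  <= (1 / 2) ^+ 2 * (overlap_weight a b * overlap_weight a b) :> R.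
Proof.
have wE : (if a == b then 2 else 1) <= overlap_weight a b * overlap_weight a b.
  by rewrite /overlap_weight; case: ifP => _; lra.
apply: le_trans (ler_wpM2l (_ : 0 <= (1 / 2) ^+ 2) wE); last by rewrite sqr_ge0.
case: eqP => [->|neq].
  rewrite (@eq_avg _ _ _ _ (fun w => (good i i b b' w)%:R)); last first.
    by move=> w _; rewrite /good eqxx -natrM mulnb andbb.
  by rewrite avg_good_diag; lra.
pose e c := [set twin i c false; twin i c true].
have e_neq : e a != e b.
  apply: contra_notN neq => /eqP/set2_eq[[]|[]] /v_inj[]; last by [].
  by move=> E1 /v_inj[E2]; apply/eqP; rewrite -pair_eqE /= E1 E2 !eqxx.
pose p bs := ~~ nth false bs 0 && ~~ nth false bs 1.
rewrite (@eq_avg _ _ _ _ (fun w => (p [seq e \in w | e <- [:: e a; e b]])%:R)); last first.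
  by move=> w _; rewrite /good eqxx -natrM mulnb.
rewrite avg_bits /=.
- lra.
- by rewrite inE e_neq.
by move=> x; rewrite in_cons mem_seq1 => /orP[]/eqP->; apply: twin_slot_in.
Qed.

Definition block_mean (p : 'I_m * 'I_m) : R := if p.1 == p.2 then 1 / 2 else 3 / 8.

Lemma avg_good p a a' : avg D (fun w => (good p.1 p.2 a a' w)%:R) = block_mean p.
Proof.
rewrite /block_mean; case: eqP => [<-|/eqP ij]; first exact: avg_good_diag.
exact: avg_good_cross.
Qed.

Local Notation selection := {ffun 'I_m -> choice}.
Implicit Types (t s : selection).

Lemma avg_good_good p t s :
  avg D (fun w => (good p.1 p.2 (t p.1) (t p.2) w)%:R * (good p.1 p.2 (s p.1) (s p.2) w)%:R)
  <= block_mean p ^+ 2 * (overlap_weight (t p.1) (s p.1) * overlap_weight (t p.2) (s p.2)).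
Proof.
rewrite /block_mean; case: eqP => [<-|/eqP ij]; first exact: avg_good_good_diag.
exact: avg_good_good_cross.
Qed.

Definition all_good t w :=
  [forall p : 'I_m * 'I_m, (p.1 <= p.2)%N ==> good p.1 p.2 (t p.1) (t p.2) w].

Lemma all_goodE t w : (all_good t w)%:R =
  \prod_(p : 'I_m * 'I_m | (p.1 <= p.2)%N) (good p.1 p.2 (t p.1) (t p.2) w)%:R :> R.
Proof.
case: (boolP (all_good t w)) => [/forallP h|].
  by rewrite big1 // => p pp; have := h p; rewrite pp /= => ->.
rewrite negb_forall => /existsP[p]; rewrite negb_imply => /andP[pp /negbTE np].
by rewrite (bigD1 p) //= np mul0r.
Qed.

Let mean := \prod_(p : 'I_m * 'I_m | (p.1 <= p.2)%N) block_mean p.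

Let mean_gt0 : 0 < mean.
Proof. by apply: prodr_gt0 => p _; rewrite /block_mean; case: ifP => _; lra. Qed.

Lemma avg_all_good t : avg D (fun w => (all_good t w)%:R) = mean.
Proof.
rewrite (@eq_avg _ _ _ _ _ (fun w _ => all_goodE t w)).
rewrite (@avg_prod _ _ _ _ _ (fun p => block p.1 p.2)).
- by apply: eq_bigr => p _; exact: avg_good.
- by move=> p _; apply: good_depends.
- by move=> [i j] [i' j'] /= ij ij'; apply: block_disjoint.
Qed.

(** Each index i occurs m + 1 times among the ordered pairs, the pair (i, i) counting twice. *)
Lemma prod_ordered_pairs (F : 'I_m -> R) :
  \prod_(p : 'I_m * 'I_m | (p.1 <= p.2)%N) (F p.1 * F p.2) = \prod_i F i ^+ m.+1.
Proof.
rewrite -(pair_big_dep xpredT (fun i j : 'I_m => (i <= j)%N) (fun i j => F i * F j)) /=.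
under eq_bigr do rewrite big_split /=.
rewrite big_split /= [X in _ * X](exchange_big_dep xpredT) //= -big_split /=.
apply: eq_bigr => i _; rewrite !prodr_const -exprD; congr (_ ^+ _).
rewrite -cardUI addnC -[m in RHS]card_ord -add1n -(card1 i); congr addn; apply: eq_card => j.
  by rewrite !inE -eqn_leq eq_sym.
by rewrite !inE leq_total.
Qed.

Lemma avg_all_good2 t s : avg D (fun w => (all_good t w)%:R * (all_good s w)%:R)
  <= mean ^+ 2 * \prod_i overlap_weight (t i) (s i) ^+ m.+1.
Proof.
rewrite (@eq_avg _ _ _ _ (fun w => \prod_(p : 'I_m * 'I_m | (p.1 <= p.2)%N)
   ((good p.1 p.2 (t p.1) (t p.2) w)%:R * (good p.1 p.2 (s p.1) (s p.2) w)%:R))); last first.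
  by move=> w _; rewrite !all_goodE -big_split.
rewrite (@avg_prod _ _ _ _ _ (fun p => block p.1 p.2)).
- rewrite -prod_ordered_pairs /mean -prodrXl -big_split /=; apply: ler_prod => p _.
  rewrite avg_good_good andbT -[X in X <= _](avg_cst D 0); apply: avg_le => w _.
  by rewrite mulr_ge0.
- by move=> p _ w w' E; rewrite !(good_depends _ _ E).
- by move=> [i j] [i' j'] /= ij ij'; apply: block_disjoint.
Qed.

(** The second moment method. By the product bounds above, the second moment of the number X
    of good selections is at most its squared mean times the average over pairs of selections of
    a product over the cells of (5 / 3) ^ (m + 1) for equal choices and 1 otherwise. With M = N ^ 2
    choices per cell and H = (5 / 3) ^ (m + 1) this average is at most (1 + H / M) ^ m, so that
    X is positive with probability at least (1 + H / M) ^ (- m) >= 1 - m H / M. *)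
Lemma twins_exist : (0 < N)%N ->
  1 - m%:R * ((5 / 3) ^+ m.+1 / N%:R ^+ 2)
  <= avg D (fun w => [exists t, all_good t w]%:R) :> R.
Proof.
move=> N0; pose M : R := N%:R ^+ 2; pose H : R := (5 / 3) ^+ m.+1.
have M0 : 0 < M by rewrite exprn_gt0 // ltr0n.
have H0 : 0 < H by rewrite exprn_gt0 //; lra.
have cardM : #|{: choice}|%:R = M by rewrite card_prod card_ord natrM.
have sumc (c : R) : \sum_(t : selection) c = M ^+ m * c.
  rewrite big_const iter_addr_0 -mulr_natl; congr (_ * _).
  by rewrite -cardM -natrX -[m in RHS]card_ord -card_ffun.
pose X w : R := \sum_t (all_good t w)%:R.
have EX : avg D X = M ^+ m * mean.
  rewrite avg_sum; under eq_bigr do rewrite avg_all_good.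
  exact: sumc.
have EX2 : avg D (fun w => X w ^+ 2) <= mean ^+ 2 * (M ^+ m * (M + H) ^+ m).
  rewrite (@eq_avg _ _ _ _ (fun w => \sum_t \sum_s (all_good t w)%:R * (all_good s w)%:R));
    last by move=> w _; rewrite expr2 /X big_distrlr.
  rewrite avg_sum; under eq_bigr do rewrite avg_sum.
  apply: (@le_trans _ _ (\sum_(t : selection) mean ^+ 2 * (M + H) ^+ m)); last first.
    by rewrite sumc mulrCA.
  apply: ler_sum => t _.
  apply: (@le_trans _ _ (\sum_(s : selection) mean ^+ 2 *
      \prod_i overlap_weight (t i) (s i) ^+ m.+1)).
    by apply: ler_sum => s _; exact: avg_all_good2.
  rewrite -mulr_sumr ler_wpM2l ?sqr_ge0 //.
  (* Summing over s a product over the cells gives a product of sums over single choices. *)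
  rewrite -(bigA_distr_bigA (fun i c => overlap_weight (t i) c ^+ m.+1)) /=.
  rewrite -[X in _ <= _ ^+ X]card_ord -prodr_const; apply: ler_prod => i _.
  have w0 c : 0 <= overlap_weight (t i) c by rewrite /overlap_weight; case: ifP => _; lra.
  rewrite sumr_ge0 => [/=|c _]; last by rewrite exprn_ge0.
  rewrite (bigD1 (t i)) //= {1}/overlap_weight eqxx addrC lerD2r.
  rewrite (eq_bigr (fun=> 1)) => [|c /negbTE neq]; last first.
    by rewrite /overlap_weight eq_sym neq expr1n.
  by rewrite sumr_const -cardM ler_nat max_card.
have MH : 0 < M + H by rewrite addr_gt0.
have B0 : 0 < mean ^+ 2 * (M ^+ m * (M + H) ^+ m).
  by apply: mulr_gt0; [|apply: mulr_gt0]; apply: exprn_gt0.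
apply: (@le_trans _ _ (avg D (fun w => (X w != 0)%:R))); last first.
  apply: avg_le => w _; rewrite ler_nat; case: eqP => //= X0.
  rewrite lt0b; apply/existsP.
  have /existsP[t tg] : [exists t, all_good t w]; last by exists t.
  apply: contra_notT X0 => /existsPn none; rewrite /X big1 // => t _.
  by rewrite (negbTE (none t)).
apply: le_trans (second_moment B0 EX2); rewrite EX.
have -> : (M ^+ m * mean) ^+ 2 / (mean ^+ 2 * (M ^+ m * (M + H) ^+ m)) =
    (1 - H / (M + H)) ^+ m.
  have -> : 1 - H / (M + H) = M / (M + H) by field; rewrite gt_eqF.
  rewrite expr_div_n; field.
  apply/and3P; split; last exact: lt0r_neq0.
    by apply/expf_neq0/lt0r_neq0.
  by apply/expf_neq0/lt0r_neq0.
apply: (le_trans _ (bernoulli m _)); last first.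
  apply/andP; split; first by apply: divr_ge0; exact: ltW.
  by rewrite ler_pdivrMr // mul1r lerDr ltW.
by rewrite lerB // ler_wpM2l // ler_wpM2l ?(ltW H0) // lef_pV2 ?posrE // lerDl ltW.
Qed.

End TwinFamilies.

(** * The independence number is at most 2 log2 n *)

Section SmallAlpha.
Variables (R : realFieldType) (T : finType).
Local Notation D := (two_sets T).

Definition pairs_in (B : {set T}) : {set {set T}} :=
  [set e : {set T} | (e \subset B) && (#|e| == 2%N)].

Definition misses_set K (w : {set {set T}}) : bool :=
  [exists B : {set T}, (#|B| == K) && [disjoint w & pairs_in B]].

Lemma alpha_le (G : sgraph T) k : ~~ misses_set k.+1 (edges G) -> (alpha G <= k)%N.
Proof.
move=> /existsPn none; apply/bigmax_leqP => A /forall_inP indA.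
rewrite leqNgt; apply/negP => kA.
have : (0 < #|[set B : {set T} | (B \subset A) && (#|B| == k.+1)]|)%N.
  by rewrite cards_draws bin_gt0.
case/card_gt0P => B; rewrite inE => /andP[BA cB].
have := none B; rewrite cB /= => /negP; apply.
apply/pred0P => e /=; apply/negP => /andP[eG]; rewrite inE => /andP[eB _].
have [x [y [eE xy]]] := edge_adj eG; rewrite eE in eB.
have xA : x \in A by apply/(subsetP BA)/(subsetP eB); rewrite set21.
have yA : y \in A by apply/(subsetP BA)/(subsetP eB); rewrite set22.
by have := indA _ xA => /forall_inP/(_ _ yA); rewrite xy.
Qed.

(** The union bound over the sets of K vertices. *)
Lemma avg_misses_set K :
  avg D (fun w => (misses_set K w)%:R) <= 'C(#|T|, K)%:R * 2 ^- 'C(K, 2) :> R.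
Proof.
apply: (@le_trans _ _ (avg D (fun w =>
    \sum_(B : {set T} | #|B| == K) [disjoint w & pairs_in B]%:R))).
  apply: avg_le => w _; case: (boolP (misses_set K w)) => [|_]; last exact: sumr_ge0.
  move=> /existsP[B /andP[cB dB]]; rewrite (bigD1 B) //= dB lerDl.
  exact: sumr_ge0.
rewrite avg_sum (eq_bigr (fun=> 2 ^- 'C(K, 2))) => [|B /eqP cB]; last first.
  rewrite avg_disjoint; first by rewrite /pairs_in cards_draws cB.
  by apply/subsetP => e; rewrite !inE => /andP[].
by rewrite sumr_const -[_ *+ _]mulr_natl -card_draws cardsE.
Qed.

Lemma exp2_le_fact k : (2 ^ k <= k.+1`!)%N.
Proof. by elim: k => // k IHk; rewrite expnS factS leq_mul. Qed.

Lemma ffact_le_exp n k : (n ^_ k <= n ^ k)%N.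
Proof.
elim: k => // k IHk; rewrite ffactnSr expnSr leq_mul ?leq_subr //.
Qed.

(** With K = k + 1 and n ^ 2 < 2 ^ K, the bound 'C(n, K) K! <= n ^ K gives
    ('C(n, K) K!) ^ 2 <= 2 ^ (K ^ 2) = 2 ^ (2 'C(K, 2)) 2 ^ K; the factor K! then absorbs both the
    excess 2 ^ K and the factor n ^ 2. *)
Lemma bin_le_exp2 n k : (n ^ 2 < 2 ^ k.+1)%N -> ('C(n, k.+1) * n <= 2 * 2 ^ 'C(k.+1, 2))%N.
Proof.
set K := k.+1 => nK; rewrite -(@leq_exp2r _ _ 2) // !expnMn -!expnM.
have C2 : ('C(K, 2) * 2 = K * k)%N.
  by have := mul_bin_diag K 1; rewrite bin1 /= mulnC => ->; rewrite mulnC.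
have CK : ('C(n, K) ^ 2 * (K`! ^ 2) <= 2 ^ ('C(K, 2) * 2) * 2 ^ K)%N.
  rewrite -expnMn bin_ffact -expnD C2 -mulnSr expnM.
  apply: (@leq_trans ((n ^ K) ^ 2)); first by rewrite leq_exp2r // ffact_le_exp.
  by rewrite -!expnM mulnC expnM mulnC expnM leq_exp2r // ltnW.
have K2 : (2 ^ k * 2 ^ k <= K`! ^ 2)%N by rewrite -mulnn leq_mul ?exp2_le_fact.
have P0 : (0 < 2 ^ k * 2 ^ k)%N by rewrite muln_gt0 !expn_gt0.
rewrite -(leq_pmul2r P0).
have -> : (2 ^ 2 * 2 ^ ('C(K, 2) * 2) * (2 ^ k * 2 ^ k) =
           2 ^ ('C(K, 2) * 2) * 2 ^ K * 2 ^ K)%N.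
  by rewrite [(2 ^ K)%N]expnS; move: (2 ^ k)%N (2 ^ ('C(K, 2) * 2))%N => Y X; lia.
apply: (@leq_trans ('C(n, K) ^ 2 * n ^ 2 * K`! ^ 2)); first by rewrite leq_mul2l K2 orbT.
by rewrite mulnAC leq_mul // ltnW.
Qed.

Lemma avg_misses_log (n := #|T|) : (0 < n)%N ->
  avg D (fun w => (misses_set (trunc_log 2 (n ^ 2)).+1 w)%:R) <= 2 / n%:R :> R.
Proof.
move=> n0; apply: le_trans (avg_misses_set _) _; rewrite -/n.
set k := trunc_log _ _; rewrite ler_pdivrMr ?exprn_gt0 // mulrAC ler_pdivlMr ?ltr0n //.
by rewrite -!natrX -!natrM ler_nat bin_le_exp2 // trunc_log_ltn.
Qed.

End SmallAlpha.

(** * Probabilities in the random graph, and the limit *)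

From mathcomp Require Import all_classical all_reals all_analysis.

Import numFieldNormedType.Exports.
Local Open Scope classical_set_scope.
Local Open Scope ring_scope.

Section RandomGraphBounds.
Variables (R : realType).

Lemma gnp_prE n (A : pred (sgraph 'I_n)) (a : {set {set 'I_n}} -> bool) :
  (forall G, A G = a (edges G)) ->
  gnp_pr (2^-1 : R) A = avg (two_sets 'I_n) (fun w => (a w)%:R).
Proof.
move=> Aa; rewrite /gnp_pr /avg.
have weightE (G : sgraph 'I_n) : gnp_weight (2^-1 : R) G = 2 ^- #|two_sets 'I_n|.
  rewrite /gnp_weight (eq_bigr (fun=> 2^-1)) => [|e _]; last by case: ifP => _; lra.
  by rewrite prodr_const -exprVn cardsE.
rewrite mulr_suml (reindex_omap (@edges 'I_n) insub) => [|w]; last first.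
  rewrite inE => /fintype.subsetP wD; rewrite insubT //=.
  by apply/forall_inP => e /wD; rewrite inE.
rewrite big_mkcond [RHS]big_mkcond; apply: eq_bigr => G _.
have -> : edges G \in powerset (two_sets 'I_n).
  by rewrite inE; apply/fintype.subsetP => e eG; rewrite inE (forall_inP (edgesP G)).
rewrite valK eqxx weightE Aa.
by case: (a _); rewrite ?mul1r ?mul0r.
Qed.

(** The union bound, for a good event a and a bad event b stated on edge sets. *)
Lemma gnp_pr_ge n (A : pred (sgraph 'I_n)) (a b : {set {set 'I_n}} -> bool) :
  (forall G, a (edges G) -> ~~ b (edges G) -> A G) ->
  avg (two_sets 'I_n) (fun w => (a w)%:R) - avg (two_sets 'I_n) (fun w => (b w)%:R)
  <= gnp_pr (2^-1 : R) A.
Proof.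
move=> abA.
pose A' w := if insub w is Some G then A G else false.
rewrite (@gnp_prE _ _ A'); last by move=> G; rewrite /A' valK.
rewrite lerBlDr -avgD; apply: avg_le => w wD.
have wG : [forall e in w, #|e| == 2%N].
  by apply/forall_inP => e /(fintype.subsetP wD); rewrite inE.
rewrite -natrD ler_nat /A' (valK (SGraph wG) : insub w = Some _); have := abA (SGraph wG).
by case: (a w) (b w) (A _) => [] [] [] //= /(_ isT isT).
Qed.

Lemma gnp_pr_le1 n (A : pred (sgraph 'I_n)) : gnp_pr (2^-1 : R) A <= 1.
Proof.
pose A' w := if insub w is Some G then A G else false.
rewrite (@gnp_prE _ _ A'); last by move=> G; rewrite /A' valK.
rewrite -[X in _ <= X](avg_cst (two_sets 'I_n) (1 : R)); apply: avg_le => w _.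
by rewrite lern1 leq_b1.
Qed.

Lemma bc_all_good n m N (v : 'I_m * bool * 'I_N -> 'I_n) (t : {ffun 'I_m -> 'I_N * 'I_N})
  (G : sgraph 'I_n) : injective v -> all_good v t (edges G) -> (bc G + m <= n)%N.
Proof.
move=> v_inj /forallP tg; rewrite -[n in (_ <= n)%N]card_ord.
apply: (@bc_le_twins _ _ _ (fun p => twin v p.1 (t p.1) p.2)).
- by move=> [i b] [j c] /v_inj[-> -> _].
- by move=> i; have := tg (i, i); rewrite leqnn /good eqxx.
move=> i j ij; have := tg (i, j); rewrite (ltnW ij) /= /good.
by case: eqP => // E; rewrite E ltnn in ij.
Qed.

Lemma log2_le (x : R) k : 0 < x -> x <= 2 ^+ k -> log2 x <= k%:R.
Proof.
move=> x0 xk; have l2 : 0 < ln 2 :> R by rewrite ln_gt0 // ltr1n.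
rewrite /log2 ler_pdivrMr // mulr_natl -lnXn // ler_ln // posrE ?exprn_gt0 //.
Qed.

Lemma log2_ge (x : R) k j : 0 < x -> 2 ^+ k <= x ^+ j -> k%:R <= j%:R * log2 x.
Proof.
move=> x0 xk; have l2 : 0 < ln 2 :> R by rewrite ln_gt0 // ltr1n.
rewrite /log2 mulrA ler_pdivlMr // !mulr_natl -!lnXn // ler_ln // posrE exprn_gt0 //.
Qed.

Lemma injection_exists m N n : (m * 2 * N <= n)%N ->
  exists v : 'I_m * bool * 'I_N -> 'I_n, injective v.
Proof.
move=> le_n.
have card_le : (#|{: 'I_m * bool * 'I_N}| <= n)%N by rewrite !card_prod !card_ord card_bool.
exists (fun p => widen_ord card_le (enum_rank p)) => p q.
by move=> /(congr1 val) /= /val_inj/enum_rank_inj.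
Qed.

Lemma exp4_le_exp2 q : (q.+1 ^ 4 <= 2 ^ 10 * 2 ^ q)%N.
Proof.
elim: q => // q IHq; case: (leqP 5 q) => [q5|]; last by case: q {IHq} => [|[|[|[|[|q]]]]].
rewrite (expnS 2 q) mulnCA; apply: leq_trans (leq_mul (leqnn 2) IHq).
rewrite !(expnS, expn0, muln1).
by have [r ->] : exists r, q = (r + 5)%N; [exists (q - 5)%N; lia|nia].
Qed.

(** With m = 9 (q + 1) pairs, this provides n >= 2 m vertices, so that N is positive. *)
Lemma pairs_fit q : (2 <= q)%N -> (18 * q.+1 <= 16 ^ q)%N.
Proof.
elim: q => // q IHq; case: (leqP 2 q) => [q2 _|]; last by case: q {IHq} => [|[|q]].
by rewrite expnS; have := IHq q2; lia.
Qed.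

(** With m = 9 (q + 1) and 16 ^ q <= n, the quantity (5 / 3) ^ (m + 1) grows like 128 ^ q at most,
    since (5 / 3) ^ 9 < 128, whereas N >= 16 ^ q / (36 (q + 1)), so that N ^ 2 is
    at least 256 ^ q up to a quadratic factor. In the constant, 9 comes from m, 1296 is 36 ^ 2,
    256 bounds 128 * 5 / 3, and 2 ^ 10 is paid to trade (q + 1) ^ 3 / 2 ^ q for 1 / (q + 1). *)
Lemma twins_error n (q := trunc_log 16 n) (m := (9 * q.+1)%N) (N := (n %/ (m * 2))%N) :
  (0 < n)%N -> (0 < N)%N ->
  m%:R * ((5 / 3) ^+ m.+1 / N%:R ^+ 2) <= (9 * 1296 * 2 ^+ 10 * 256) / q.+1%:R :> R.
Proof.
move=> n0 N0; set C : R := (9 * _).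
have n16 : (16 ^ q <= n)%N by apply: trunc_logP.
have nN : (16 ^ q <= 36 * q.+1 * N)%N.
  apply: (leq_trans n16).
  have n_lt : (n < N.+1 * (m * 2))%N by rewrite -ltn_divLR // /m muln_gt0.
  apply: leq_trans (ltnW n_lt) _; rewrite /m; nia.
have Q0 : 0 < q.+1%:R :> R by rewrite ltr0n.
have N0' : 0 < N%:R :> R by rewrite ltr0n.
have X_le : (5 / 3) ^+ m.+1 <= 256 * 128 ^+ q :> R.
  rewrite exprS /m exprM.
  have b : (5 / 3 : R) ^+ 9 <= 128 by lra.
  have : ((5 / 3 : R) ^+ 9) ^+ q.+1 <= 128 ^+ q.+1.
    by rewrite lerXn2r ?nnegrE ?exprn_ge0 //; lra.
  rewrite (exprS 128); have : 0 < ((5 / 3 : R) ^+ 9) ^+ q.+1 by rewrite !exprn_gt0 //; lra.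
  lra.
have NQ : 256 ^+ q <= N%:R ^+ 2 * (36 * q.+1%:R) ^+ 2 :> R.
  have -> : 256 = 16 ^+ 2 :> R by lra.
  rewrite exprAC -exprMn lerXn2r ?nnegrE ?exprn_ge0 ?mulr_ge0 //.
  by rewrite mulrC -!natrM -natrX ler_nat.
have Q4 : q.+1%:R ^+ 4 <= 2 ^+ 10 * 2 ^+ q :> R.
  by rewrite -!natrX -natrM ler_nat exp4_le_exp2.
rewrite mulrA ler_pdivrMr ?exprn_gt0 // mulrAC ler_pdivlMr //.
have d0 : 0 < (36 * q.+1%:R) ^+ 2 :> R by rewrite exprn_gt0 // mulr_gt0.
rewrite -(ler_pM2r d0) /m natrM; set Q := q.+1%:R in Q0 NQ Q4 d0 *.
set X := _ ^+ m.+1 in X_le *.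
have X0 : 0 <= X by rewrite /X exprn_ge0 //; lra.
have Q40 : 0 <= Q ^+ 4 by rewrite exprn_ge0 // ltW.
have := ler_pM Q40 X0 Q4 X_le.
have E256 : 256 ^+ q = 2 ^+ q * 128 ^+ q :> R by rewrite -exprMn; congr (_ ^+ _); lra.
rewrite E256 in NQ; rewrite /C [2 ^+ 10 * _ * _]mulrACA.
have -> : 9%:R * Q * X * Q * (36 * Q) ^+ 2 = 9 * 1296 * (Q ^+ 4 * X) by ring.
move: (2 ^+ q * _) NQ (Q ^+ 4 * X) => A NQ P.
rewrite -[_ * _ ^+ 2 * (_ ^+ 2)]mulrA.
move: (_ * (36 * Q) ^+ 2) NQ => B; lra.
Qed.

End RandomGraphBounds.

(** The number m of pairs is at least (9 / 4) log2 n, as n < 16 ^ (q + 1); this is the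
    coefficient 2 + 2 c for c = 1 / 8. *)
Lemma probability_bound (R : realType) (n : nat) (q := trunc_log 16 n) :
  (256 <= n)%N ->
  1 - (9 * 1296 * 2 ^+ 10 * 256 + 2) / q.+1%:R <=
  gnp_pr (2^-1 : R) (fun G : sgraph 'I_n =>
         ((bc G)%:R <= n%:R - (2 + 2 * (8^-1 : R)) * log2 n%:R) &&
         (n%:R - (2 + 2 * (8^-1 : R)) * log2 n%:R <= n%:R - (1 + (8^-1 : R)) * (alpha G)%:R)).
Proof.
move=> n256; have n0 : (0 < n)%N by apply: leq_trans n256.
have nR0 : 0 < n%:R :> R by rewrite ltr0n.
have q2 : (2 <= q)%N by apply: (@trunc_log_max 16 n 2).
have n16 : (16 ^ q <= n)%N by apply: trunc_logP.
pose m := (9 * q.+1)%N; pose N := (n %/ (m * 2))%N.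
have N0 : (0 < N)%N.
  rewrite divn_gt0 // (leq_trans _ n16) // (leq_trans _ (pairs_fit q2)) // /m.
  by rewrite mulnAC.
have [v v_inj] : exists v : 'I_m * bool * 'I_N -> 'I_n, injective v.
  by apply: injection_exists; rewrite mulnC leq_divM.
pose k := trunc_log 2 (n ^ 2).
have logq : log2 n%:R <= (4 * q.+1)%:R :> R.
  by apply: log2_le => //; rewrite -natrX ler_nat expnM ltnW // trunc_log_ltn.
have logk : k%:R <= 2 * log2 n%:R :> R.
  by apply: log2_ge => //; rewrite -!natrX ler_nat trunc_logP // expn_gt0 n0.
apply: (le_trans _ (@gnp_pr_ge R n _
  (fun w => [exists t, all_good v t w]) (misses_set k.+1) _)); last first.
  move=> G /existsP[t /(bc_all_good v_inj) bcG] /alpha_le alG.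
  have bcR : (bc G)%:R + m%:R <= n%:R :> R by rewrite -natrD ler_nat.
  have alR : (alpha G)%:R <= k%:R :> R by rewrite ler_nat.
  move: logq bcR; rewrite /m !natrM; set Q := q.+1%:R => logq bcR.
  by apply/andP; split; lra.
have twins := twins_exist R v_inj N0.
have err := twins_error R n0 N0.
have := @avg_misses_log R 'I_n; rewrite card_ord => /(_ n0) miss.
have n_ge : 2 / n%:R <= 2 / q.+1%:R :> R.
  rewrite ler_wpM2l // lef_pV2 ?posrE ?ltr0n // ler_nat (leq_trans _ n16) //.
  by rewrite ltn_expl.
rewrite mulrDl opprD addrA; apply: lerB; last exact: le_trans miss n_ge.
by apply: le_trans twins; rewrite lerB.
Qed.

Theorem theorem1p1 (R : realType) :
  exists c : R, 0 < c /\
    (fun n : nat =>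
       gnp_pr (2^-1 : R) (fun G : sgraph 'I_n =>
         ((bc G)%:R <= n%:R - (2 + 2 * c) * log2 n%:R) &&
         (n%:R - (2 + 2 * c) * log2 n%:R <= n%:R - (1 + c) * (alpha G)%:R)))
      @ \oo --> (1 : R).
Proof.
exists 8^-1; split; first by rewrite invr_gt0.
apply/cvgrPdist_le => e e0.
pose C : R := 9 * 1296 * 2 ^+ 10 * 256 + 2.
pose K := Num.truncn (C / e).
near=> n.
(* The exponent exceeds K by 2 in order to have n >= 256 as well. *)
have nK : (16 ^ K.+2 <= n)%N by near: n; exact: nbhs_infty_ge.
have Kq : (K.+2 <= trunc_log 16 n)%N by apply: trunc_log_max.
have n256 : (256 <= n)%N by apply: leq_trans nK; rewrite (@leq_pexp2l 16 2).
rewrite ger0_norm ?subr_ge0 ?gnp_pr_le1 //.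
rewrite lerBlDr addrC -lerBlDr; apply: (le_trans _ (probability_bound R n256)).
rewrite lerB // -/C ler_pdivrMr ?ltr0n // mulrC -ler_pdivrMr //.
apply: (le_trans (ltW (truncnS_gt (C / e)))); rewrite ler_nat -/K.
by apply: leq_trans (leqnSn _); apply: leq_trans Kq.
Unshelve. all: by end_near.
Qed.
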